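(* For any DP-game $(\mathcal{D},\mathcal{A},C)$ with hidden choice, there exists a Nash equilibrium, i.e. a mixed strategy profile $(\delta^*,\alpha^* )\in\mathbb{D}\mathcal{D}\times\mathbb{D}\mathcal{A}$ with $$\mathbb{V}^{\rm DP}(\delta^*,\alpha)\le\mathbb{V}^{\rm DP}(\delta^*,\alpha^* )\le\mathbb{V}^{\rm DP}(\delta,\alpha^* )\qquad\text{for all }\delta\in\mathbb{D}\mathcal{D},\ \alpha\in\mathbb{D}\mathcal{A}.$$ Moreover, an arbitrary mixed strategy $\alpha^*\in\mathbb{D}\mathcal{A}$ such that $\mathrm{supp}(\alpha^* )=\mathcal{A}$ is an optimal strategy for the attacker.
   Context: For a finite set $\mathcal{I}$, $\mathbb{D}\mathcal{I}$ is the set of probability distributions on $\mathcal{I}$, and $\mathrm{supp}(\mu)=\{i:\mu(i)>0\}$. A channel $C:\mathcal{X}\times\mathcal{Y}\to\mathbb{R}$ ($\mathcal{X},\mathcal{Y}$ finite) satisfies $0\le C(x,y)\le1$ and $\sum_yC(x,y)=1$ for every $x$. Given a symmetric binary relation $\sim$ on $\mathcal{X}$, a channel $C$ is conforming to $\sim$ if for all $x\sim x'$ and all $y$: $C(x,y)=0$ iff $C(x',y)=0$. For such a channel, its differential-privacy level is $$\mathbb{V}^{\rm DP}[C]=\max_{\substack{y,x,x':\ x\sim x',\\ C(x,y)>0}}\ln\frac{C(x,y)}{C(x',y)}$$ (with the convention that the maximum is $0$ if $\sim$ is empty). Visible choice: for a finite family $\{C_i\}_{i\in\mathcal{I}}$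 of channels $\mathcal{X}\times\mathcal{Y}\to\mathbb{R}$ and $\mu\in\mathbb{D}\mathcal{I}$, $\bigsqcup_{i\leftarrow\mu}C_i$ is the channel from $\mathcal{X}$ to the disjoint union $\{(y,i):y\in\mathcal{Y},i\in\mathcal{I}\}$ given by $(x,(y,i))\mapsto\mu(i)C_i(x,y)$. A DP-game $(\mathcal{D},\mathcal{A},C)$ consists of nonempty finite sets $\mathcal{D}$ (defender's actions) and $\mathcal{A}$ (attacker's actions) and a family $\{C_{da}\}_{d\in\mathcal{D},a\in\mathcal{A}}$ of channels $\mathcal{X}\times\mathcal{Y}\to\mathbb{R}$ all conforming to a symmetric relation $\sim$ on $\mathcal{X}$. The game is zero-sum: the attacker maximizes and the defender minimizes the attacker's utility. With hidden choice, the attacker's utility of a mixed strategy profile $(\delta,\alpha)$ is $$\mathbb{V}^{\rm DP}(\delta,\alpha)=\mathbb{V}^{\rm DP}\Bigl[\bigsqcup_{a\leftarrow\alpha}\ \sum_d\delta(d)C_{da}\Bigr]$$ (entrywise sum of matrices). A strategy of a player is optimal if it is that player's component of some Nash equilibrium. *)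

(* Defs.v *)
From mathcomp Require Import all_boot all_order all_algebra.
From mathcomp Require Import reals exp.
Set Implicit Arguments.
Unset Strict Implicit.
Unset Printing Implicit Defensive.
Import Order.TTheory GRing.Theory Num.Theory.
Local Open Scope ring_scope.

Definition is_dist (R : realType) (I : finType) (mu : I -> R) : Prop :=
  (forall i, 0 <= mu i) /\ \sum_i mu i = 1.

Definition supp (R : realType) (I : finType) (mu : I -> R) : {set I} :=
  [set i | 0 < mu i].

Definition is_channel (R : realType) (X Y : finType) (C : X -> Y -> R) : Prop :=
  (forall x y, 0 <= C x y <= 1) /\ (forall x, \sum_y C x y = 1).

Definition conforming (R : realType) (X Y : finType) (adj : rel X)
    (C : X -> Y -> R) : Prop :=
  forall x x' y, adj x x' -> (C x y = 0 <-> C x' y = 0).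

Definition DP_index (R : realType) (X Y : finType) (adj : rel X)
    (C : X -> Y -> R) : pred (Y * X * X) :=
  fun t => let: (y, x, x') := t in adj x x' && (0 < C x y).

Definition DP_value (R : realType) (X Y : finType) (C : X -> Y -> R)
    (t : Y * X * X) : R :=
  let: (y, x, x') := t in ln (C x y / C x' y).

(* For a channel C, the index set is empty exactly when [adj] is, because every
   row of C has a positive entry; the default value 0 is thus the convention
   for the empty relation. *)
Definition VDP (R : realType) (X Y : finType) (adj : rel X)
    (C : X -> Y -> R) : R :=
  if [pick t | DP_index adj C t] is Some t0
  then DP_value C [arg max_(t > t0 | DP_index adj C t) DP_value C t]%O
  else 0.

Definition visible_choice (R : realType) (I X Y : finType) (mu : I -> R)
    (C : I -> X -> Y -> R) : X -> Y * I -> R :=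
  fun x yi => mu yi.2 * C yi.2 x yi.1.

Definition hidden_choice (R : realType) (I X Y : finType) (mu : I -> R)
    (C : I -> X -> Y -> R) : X -> Y -> R :=
  fun x y => \sum_i mu i * C i x y.

(* The attacker's choice is visible, the defender's one is hidden. *)
Definition DP_utility (R : realType) (X Y D A : finType) (adj : rel X)
    (C : D -> A -> X -> Y -> R) (delta : D -> R) (alpha : A -> R) : R :=
  VDP adj (visible_choice alpha (fun a => hidden_choice delta (C^~ a))).

Definition is_DP_game (R : realType) (X Y D A : finType) (adj : rel X)
    (C : D -> A -> X -> Y -> R) : Prop :=
  [/\ symmetric adj, (0 < #|D|)%N, (0 < #|A|)%N
    & forall d a, is_channel (C d a) /\ conforming adj (C d a)].

(* Zero-sum: [u] is the attacker's utility, minimized by the defender (first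
   argument) and maximized by the attacker (second argument). *)
Definition is_Nash (R : realType) (D A : finType)
    (u : (D -> R) -> (A -> R) -> R) (delta : D -> R) (alpha : A -> R) : Prop :=
  [/\ is_dist delta, is_dist alpha,
      forall alpha', is_dist alpha' -> u delta alpha' <= u delta alpha
    & forall delta', is_dist delta' -> u delta alpha <= u delta' alpha].

Definition attacker_optimal (R : realType) (D A : finType)
    (u : (D -> R) -> (A -> R) -> R) (alpha : A -> R) : Prop :=
  exists delta, is_Nash u delta alpha.

(* Main.v *)
(** The inequality [VDP C <= v], for [0 <= v], is equivalent to the finite
    system [C x y <= expR v * C x' y] ([adj x x']), which holds trivially where
    [C x y = 0].  Hence an attacker strategy weakens the constraints on the
    defender exactly by dropping those of the actions it never plays: every
    strategy with full support is a best reply to every defender strategy.  The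
    defender then has to minimize the least factor [c >= 1] for which her
    strategy satisfies the system for all attacker actions.  This factor is in
    general discontinuous in [delta] where supports change, but the pairs
    [(delta, c)] satisfying the system with [c] bounded form a compact set, so
    the minimum is attained. *)
Require Import Defs.
From mathcomp Require Import all_boot all_order all_algebra.
From mathcomp Require Import reals exp.
From mathcomp Require Import classical_sets topology normedtype sequences derive.
From mathcomp Require Import lra.
Set Implicit Arguments.
Unset Strict Implicit.
Unset Printing Implicit Defensive.
Import Order.TTheory GRing.Theory Num.Theory.
Import numFieldNormedType.Exports.
Local Open Scope ring_scope.

Definition DP_bounded {R : realType} {X Y : finType} (adj : rel X) (c : R)
    (C : X -> Y -> R) : Prop :=
  forall x x' y, adj x x' -> C x y <= c * C x' y.

Lemma DP_value_le_VDP {R : realType} {X Y : finType} (adj : rel X)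
    (C : X -> Y -> R) (t : Y * X * X) :
  DP_index adj C t -> DP_value C t <= VDP adj C.
Proof.
rewrite /VDP => Ct; case: pickP => [t0 Ct0|/(_ t)]; last by rewrite Ct.
by case: (@arg_maxP _ _ _ t0 (DP_index adj C) (DP_value C) Ct0) => s _; apply.
Qed.

Lemma VDP_attained {R : realType} {X Y : finType} (adj : rel X)
    (C : X -> Y -> R) :
  VDP adj C = 0 \/ exists2 t, DP_index adj C t & VDP adj C = DP_value C t.
Proof.
rewrite /VDP; case: pickP => [t0 Ct0|_]; last by left.
right; case: (@arg_maxP _ _ _ t0 (DP_index adj C) (DP_value C) Ct0) => s Cs _.
by exists s.
Qed.

Section NonnegativeConforming.
Variables (R : realType) (X Y : finType) (adj : rel X) (C : X -> Y -> R).
Hypotheses (C_ge0 : forall x y, 0 <= C x y) (C_conf : conforming adj C).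

(** Ensures that the ratio in [DP_value] at an admissible triple is a genuine positive quotient, so
    that the default values of division by zero and of [ln] never enter. *)
Let gt0_adj x x' y : adj x x' -> 0 < C x y -> 0 < C x' y.
Proof.
move=> xx'; rewrite !lt0r !C_ge0 !andbT => Cxy.
by apply: contra_neq Cxy => /(C_conf y xx').
Qed.

(** Swapping the two adjacent inputs negates the log-ratio, and by symmetry the swapped triple is
    admissible too; so an attained maximum is at least its own opposite. *)
Lemma VDP_ge0 : symmetric adj -> 0 <= VDP adj C.
Proof.
move=> adjC; case: (VDP_attained adj C) => [->//|[[[y x] x'] Ct Vt]].
have /andP[xx' Cxy] := Ct; have Cx'y := gt0_adj xx' Cxy.
have /DP_value_le_VDP : DP_index adj C (y, x', x) by rewrite /= adjC xx'.
move: Vt; rewrite /DP_value !ln_div ?posrE //; lra.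
Qed.

Lemma VDP_le v : 0 <= v -> VDP adj C <= v <-> DP_bounded adj (expR v) C.
Proof.
move=> v0; split=> [Cv x x' y xx'|Cv].
  have := C_ge0 x y; rewrite le0r => /predU1P[->|Cxy].
    by rewrite mulr_ge0 ?expR_ge0.
  have Cx'y := gt0_adj xx' Cxy.
  have /DP_value_le_VDP/le_trans/(_ Cv) : DP_index adj C (y, x, x').
    by rewrite /= xx'.
  by rewrite /= -ler_expR lnK ?posrE ?divr_gt0 // ler_pdivrMr.
(* In the first alternative, which covers the default value for an empty index set, the claim is
   just [0 <= v]. *)
case: (VDP_attained adj C) => [->//|[[[y x] x'] /andP[xx' Cxy] ->]] /=.
have Cx'y := gt0_adj xx' Cxy.
by rewrite -ler_expR lnK ?posrE ?divr_gt0 // ler_pdivrMr // Cv.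
Qed.

End NonnegativeConforming.

Section LeastFactor.
Local Open Scope classical_set_scope.

Lemma closed_le_fun (R : realType) (T : topologicalType) (g h : T -> R) :
  continuous g -> continuous h -> closed [set x | g x <= h x].
Proof.
move=> gc hc.
have -> : [set x | g x <= h x] = (h \- g) @^-1` [set y : R | 0 <= y].
  by apply/seteqP; split=> x /=; rewrite subr_ge0.
apply: (@preimage_closed T R); last exact: closed_ge.
by move=> x _; apply: continuousB; [exact: hc|exact: gc].
Qed.

Variables (R : realType) (D : finType) (J : Type) (P : J -> Prop).
Variables p q : J -> D -> R.

Let dominated (c : R) (delta : D -> R) : Prop :=
  forall j, P j -> \sum_d delta d * p j d <= c * \sum_d delta d * q j d.

(* A pair (delta, c) is encoded as a point f of the product R^(option D), with
   f (Some d) = delta d and f None = c. *)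
Let T := prod_topology (fun _ : option D => (R : topologicalType)).

Let coord_continuous (o : option D) : continuous (fun f : T => f o : R).
Proof. exact: (@proj_continuous _ (fun=> R : topologicalType) o). Qed.

Let sum_coord_continuous (w : D -> R) :
  continuous (fun f : T => \sum_d f (Some d) * w d : R).
Proof.
apply: continuous_big => [|d _ f]; first exact: add_continuous.
by apply: continuousM; [exact: coord_continuous|exact: cst_continuous].
Qed.

Lemma least_dominating_factor (delta0 : D -> R) (c0 : R) :
  is_dist delta0 -> 1 <= c0 -> dominated c0 delta0 ->
  exists delta c, [/\ is_dist delta, 1 <= c, dominated c delta
    & forall delta' c', is_dist delta' -> 1 <= c' -> dominated c' delta' ->
        c <= c'].
Proof.
move=> dist0 c0_ge1 dom0.
(* Capping the factor at [c0] makes the box compact; the given feasible pair stays inside it. *)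
pose box (o : option D) : set R := if o is Some _ then `[0, 1] else `[1, c0].
pose K : set T := [set f | forall o, box o (f o)].
(* The factor 1 turns the normalization into an instance of [sum_coord_continuous]. *)
pose S : set T := [set f | \sum_d f (Some d) * 1 = 1].
pose B : set T := \bigcap_(j in [set j | P j])
  [set f : T | \sum_d f (Some d) * p j d <= f None * \sum_d f (Some d) * q j d].
have cK : compact K by apply: tychonoff => -[d|]; exact: segment_compact.
have clS : closed S.
  apply: (@preimage_closed _ R (fun f : T => \sum_d f (Some d) * 1)
    [set x | x = 1]); last exact: closed_eq.
  by move=> f _; exact: sum_coord_continuous.
have clB : closed B.
  apply: closed_bigI => j _; apply: closed_le_fun => f.
    exact: sum_coord_continuous.
  by apply: continuousM; [exact: coord_continuous|exact: sum_coord_continuous].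
have cA : compact (K `&` (S `&` B)).
  apply: (subclosed_compact _ cK); last exact: subIsetl.
  apply: closedI; last exact: closedI.
  by apply: (compact_closed _ cK); apply: hausdorff_product => ?; exact: Rhausdorff.
have mem delta c : is_dist delta -> 1 <= c <= c0 -> dominated c delta ->
    (K `&` (S `&` B)) (fun o => if o is Some d then delta d else c).
  move=> [delta_ge0 delta1] c_bd dom; split; [|split].
  - case=> [d|] /=; rewrite in_itv //= delta_ge0 /= -delta1.
    by rewrite (bigD1 d) //= lerDl sumr_ge0.
  - by rewrite /S /=; under eq_bigr do rewrite mulr1.
  - by move=> j /= Pj; exact: dom.
have [||f /set_mem[Kf [Sf Bf]] fmin] :=
    @compact_EVT_min T R (fun f : T => f None) _ _ cA.
- by eexists; apply: (mem _ c0 dist0); rewrite // c0_ge1 lexx.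
- exact/continuous_subspaceT/coord_continuous.
have /andP[f_ge1 f_le] : 1 <= f None <= c0 by have := Kf None; rewrite /= in_itv.
exists (fun d => f (Some d)), (f None); split=> //.
- split=> [d|]; first by have := Kf (Some d); rewrite /= in_itv /= => /andP[].
  by rewrite -[RHS]Sf; apply: eq_bigr => d _; rewrite mulr1.
(* A competitor with factor above [c0] lies outside the box, but the minimum is at most [c0]
   anyway. *)
- move=> delta c dist c_ge1 dom; have [c_le|/ltW] := leP c c0; last exact: le_trans.
  by apply: (fmin _ (mem_set (mem _ c dist _ dom))); rewrite c_ge1.
Qed.

End LeastFactor.

Section Game.
Variables (R : realType) (X Y D A : finType) (adj : rel X).
Variable C : D -> A -> X -> Y -> R.
Hypothesis gameC : is_DP_game adj C.

Let C_ge0 d a x y : 0 <= C d a x y.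
Proof. by have [_ _ _ /(_ d a)[[/(_ x y)/andP[]]]] := gameC. Qed.

(** A sum of nonnegative terms vanishes only if each term does, and each term keeps vanishing in an
    adjacent row because every [C d a] is conforming. *)
Lemma visible_choice_ge0_conforming delta alpha (B := visible_choice alpha
      (fun a => hidden_choice delta (C^~ a))) :
  is_dist delta -> is_dist alpha ->
  (forall x yi, 0 <= B x yi) /\ conforming adj B.
Proof.
move=> [delta_ge0 _] [alpha_ge0 _]; have [adjC _ _ chanC] := gameC.
have B_ge0 x yi : 0 <= B x yi.
  by rewrite mulr_ge0 // sumr_ge0 // => d _; rewrite mulr_ge0.
split=> //; have B0 x x' y : adj x x' -> B x y = 0 -> B x' y = 0.
  case: y => y a xx' /eqP; rewrite mulf_eq0 /= => /orP[/eqP a0|].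
    by rewrite /B /visible_choice a0 mul0r.
  rewrite psumr_eq0 => [/allP hC|d _]; last by rewrite mulr_ge0.
  rewrite /B /visible_choice /hidden_choice /= big1 ?mulr0 // => d _.
  have := hC d (mem_index_enum _); rewrite /= mulf_eq0.
  case/orP=> /eqP; first by move=> ->; rewrite mul0r.
  by have [_ /(_ _ _ y xx')[CC _]] := chanC d a; move/CC ->; rewrite mulr0.
by move=> x x' y xx'; split; apply: B0; rewrite // adjC.
Qed.

Lemma DP_utility_ge0 delta alpha : is_dist delta -> is_dist alpha ->
  0 <= DP_utility adj C delta alpha.
Proof.
move=> dd da; have [B0 Bc] := visible_choice_ge0_conforming dd da.
by have [adjC _ _ _] := gameC; exact: VDP_ge0.
Qed.

(** The weight [alpha a] multiplies both sides of each inequality: it cancels when positive, and the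
    inequality is trivial when it is zero. Hence [alpha] matters only through its support. *)
Lemma DP_utility_le delta alpha v :
  is_dist delta -> is_dist alpha -> 0 <= v ->
  DP_utility adj C delta alpha <= v <->
  forall a, a \in supp alpha ->
    DP_bounded adj (expR v) (hidden_choice delta (C^~ a)).
Proof.
move=> dd da v0; have [B0 Bc] := visible_choice_ge0_conforming dd da.
apply: (iff_trans (VDP_le B0 Bc v0)).
split=> [Bv a|Hv x x' [y a] xx'].
  rewrite inE => a0 x x' y xx'; have := Bv x x' (y, a) xx'.
  by rewrite /visible_choice /= mulrCA ler_pM2l.
rewrite /visible_choice /= mulrCA; have := da.1 a; rewrite le0r.
case/predU1P=> [->|a0]; first by rewrite !mul0r.
by rewrite ler_pM2l // Hv // inE.
Qed.

Lemma full_support_best_reply delta alpha alpha' :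
  is_dist delta -> is_dist alpha -> is_dist alpha' -> supp alpha = [set: A] ->
  DP_utility adj C delta alpha' <= DP_utility adj C delta alpha.
Proof.
move=> dd da da' full; have u0 := DP_utility_ge0 dd da.
(* The bound [v] is the utility against [alpha] itself; full support makes it hold for every
   action. *)
apply/(DP_utility_le dd da' u0) => a _.
by apply: (iffLR (DP_utility_le dd da u0)) => //; rewrite full inE.
Qed.

(** Used twice: as the feasible point that starts the defender's minimization, and as an attacker
    strategy with full support. *)
Lemma uniform_is_dist (I : finType) : (0 < #|I|)%N ->
  is_dist (fun _ : I => #|I|%:R^-1 : R).
Proof.
move=> I0; split=> [i|]; first by rewrite invr_ge0.
by rewrite sumr_const -[LHS]mulr_natl mulfV // pnatr_eq0 -lt0n.
Qed.

Lemma defender_minimizer alpha : is_dist alpha -> supp alpha = [set: A] ->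
  exists2 delta, is_dist delta & forall delta', is_dist delta' ->
    DP_utility adj C delta alpha <= DP_utility adj C delta' alpha.
Proof.
move=> da full; have [_ D0 _ _] := gameC.
pose P (j : A * X * X * Y) : Prop := adj j.1.1.2 j.1.2.
pose p (j : A * X * X * Y) d := C d j.1.1.1 j.1.1.2 j.2.
pose q (j : A * X * X * Y) d := C d j.1.1.1 j.1.2 j.2.
have utility_le delta v : is_dist delta -> 0 <= v ->
    DP_utility adj C delta alpha <= v <->
    forall j, P j ->
      \sum_d delta d * p j d <= expR v * \sum_d delta d * q j d.
  move=> dd v0; apply: (iff_trans (DP_utility_le dd da v0)).
  split=> [Hv [[[a x] x'] y] xx'|Hv a _ x x' y].
    by apply: Hv; rewrite // full inE.
  exact: (Hv (a, x, x', y)).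
have expR_ge1 (x : R) : 0 <= x -> 1 <= expR x by rewrite -expR0 ler_expR.
have dist0 := uniform_is_dist D0.
have u0 := DP_utility_ge0 dist0 da.
(* The initial factor is the exponential of the uniform strategy's own utility: feasible by
   [utility_le], and at least 1 since utilities are nonnegative. *)
have [||delta [c [dd c1 dom cmin]]] := @least_dominating_factor R D _ P p q _
  (expR (DP_utility adj C (fun=> #|D|%:R^-1) alpha)) dist0.
- exact: expR_ge1 u0.
- exact: (iffLR (utility_le _ _ dist0 u0) (lexx _)).
exists delta => // delta' dd'; have u0' := DP_utility_ge0 dd' da.
have c_gt0 : 0 < c by exact: lt_le_trans c1.
(* [ln c] separates the two utilities: feasibility of [c] bounds that of [delta] from above,
   minimality of [c] bounds that of [delta'] from below. *)
apply: (@le_trans _ _ (ln c)).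
  by apply/utility_le; rewrite ?ln_ge0 // lnK ?posrE.
rewrite -ler_expR lnK ?posrE //; apply: (cmin delta'); rewrite ?expR_ge1 //.
exact: (iffLR (utility_le _ _ dd' u0') (lexx _)).
Qed.

End Game.

Theorem theorem16 (R : realType) (X Y D A : finType) (adj : rel X)
    (C : D -> A -> X -> Y -> R) (gameC : is_DP_game adj C) :
  (exists (delta : D -> R) (alpha : A -> R),
     is_Nash (DP_utility adj C) delta alpha) /\
  (forall alpha : A -> R, is_dist alpha -> supp alpha = [set: A] ->
     attacker_optimal (DP_utility adj C) alpha).
Proof.
have opt alpha : is_dist alpha -> supp alpha = [set: A] ->
    attacker_optimal (DP_utility adj C) alpha.
  move=> da full.
  have [delta dd dmin] := defender_minimizer gameC da full.
  exists delta; split=> // alpha' da'.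
  exact: full_support_best_reply.
(* Existence follows from the second claim, applied to the uniform attacker strategy. *)
split=> //; have [_ _ A0 _] := gameC.
have [|delta Nash] := opt (fun=> #|A|%:R^-1) (uniform_is_dist R A0).
  by apply/setP => a; rewrite !inE invr_gt0 ltr0n.
by exists delta, (fun=> #|A|%:R^-1).
Qed.
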